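(* Let $T$ be a recursively enumerable $\omega$-consistent theory and let $\kappa$ be a Kreiselian sentence of $T$, i.e. a $\Sigma_3$-sentence with $\mathbb{P}\vdash\kappa\leftrightarrow\neg\,\omega\text{-}\mathtt{Con}_{T+\kappa}$. Then $\kappa$ is false in $\mathbb{N}$ and $T+\kappa$ is $\omega$-consistent.
   Context: Fix a sufficiently strong, sound arithmetical base theory $\mathbb{P}$ (e.g. Peano Arithmetic or $\mathrm{I}\Sigma_1$); $\mathbb{P}$ proves every true $\Sigma_1$-sentence. A ''theory'' is a set of arithmetical sentences containing $\mathbb{P}$. $\overline{n}$ is the numeral of $n$. $T$ is $\omega$-consistent if there is no formula $\varphi(x)$ with $T\vdash\neg\forall x\,\varphi(x)$ and $T\vdash\varphi(\overline{n})$ for all $n\in\mathbb{N}$. Fix a Gödel coding; $\ulcorner\alpha\urcorner$ is the numeral of the code of $\alpha$, and for an r.e. theory $T$ (given by a fixed $\Sigma_1$ definition) $\mathtt{Pr}_T(x)$ is the standard $\Sigma_1$ provability predicate. Let $\mho_T(\varphi)$ be the formula $\mathtt{Pr}_T(\ulcorner\neg\forall v\,\varphi(v)\urcorner)\wedge\forall w\,\mathtt{Pr}_T(\ulcorner\varphi(\overline{w})\urcorner)$ (with $\varphi$ a variable ranging over codes of formulas with one free variable), and $\omega\text{-}\mathtt{Con}_T$ the $\Pi_3$-sentence $\neg\exists\chi\,\mho_T(\chi)$. *)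

(* Defs.v *)
From Stdlib Require Import Arith List.
Import ListNotations.

(** * First-order arithmetic *)

(** The language is {0, S, +, *, <}; variables are de Bruijn indices. *)
Inductive term : Type :=
| tVar (n : nat)
| tZero
| tSucc (t : term)
| tAdd (s t : term)
| tMul (s t : term).

Inductive formula : Type :=
| fEq (s t : term)
| fLt (s t : term)
| fBot
| fImp (A B : formula)
| fAll (A : formula).

Definition fNeg (A : formula) : formula := fImp A fBot.
Definition fTop : formula := fNeg fBot.
Definition fAnd (A B : formula) : formula := fNeg (fImp A (fNeg B)).
Definition fOr (A B : formula) : formula := fImp (fNeg A) B.
Definition fIff (A B : formula) : formula := fAnd (fImp A B) (fImp B A).
Definition fEx (A : formula) : formula := fNeg (fAll (fNeg A)).

Fixpoint numeral (n : nat) : term :=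
  match n with
  | 0 => tZero
  | S n => tSucc (numeral n)
  end.

(** [shift c] increments every variable [>= c]. *)
Fixpoint shift_tm (c : nat) (t : term) : term :=
  match t with
  | tVar n => if c <=? n then tVar (S n) else tVar n
  | tZero => tZero
  | tSucc t => tSucc (shift_tm c t)
  | tAdd s t => tAdd (shift_tm c s) (shift_tm c t)
  | tMul s t => tMul (shift_tm c s) (shift_tm c t)
  end.

Fixpoint shift (c : nat) (A : formula) : formula :=
  match A with
  | fEq s t => fEq (shift_tm c s) (shift_tm c t)
  | fLt s t => fLt (shift_tm c s) (shift_tm c t)
  | fBot => fBot
  | fImp A B => fImp (shift c A) (shift c B)
  | fAll A => fAll (shift (S c) A)
  end.

(** [subst d u] replaces variable [d] by [u] and decrements every variable
    [> d], so that [subst 0 u A] is the instance A(u) of [fAll A]. *)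
Fixpoint subst_tm (d : nat) (u : term) (t : term) : term :=
  match t with
  | tVar n =>
      match n ?= d with
      | Lt => tVar n
      | Eq => u
      | Gt => tVar (pred n)
      end
  | tZero => tZero
  | tSucc t => tSucc (subst_tm d u t)
  | tAdd s t => tAdd (subst_tm d u s) (subst_tm d u t)
  | tMul s t => tMul (subst_tm d u s) (subst_tm d u t)
  end.

Fixpoint subst (d : nat) (u : term) (A : formula) : formula :=
  match A with
  | fEq s t => fEq (subst_tm d u s) (subst_tm d u t)
  | fLt s t => fLt (subst_tm d u s) (subst_tm d u t)
  | fBot => fBot
  | fImp A B => fImp (subst d u A) (subst d u B)
  | fAll A => fAll (subst (S d) (shift_tm 0 u) A)
  end.

Fixpoint fv_below_tm (d : nat) (t : term) : Prop :=
  match t with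
  | tVar n => n < d
  | tZero => True
  | tSucc t => fv_below_tm d t
  | tAdd s t | tMul s t => fv_below_tm d s /\ fv_below_tm d t
  end.

(** All free variables of the formula are [< d]; in particular [fv_below 1 A]
    says that A has at most the free variable 0. *)
Fixpoint fv_below (d : nat) (A : formula) : Prop :=
  match A with
  | fEq s t | fLt s t => fv_below_tm d s /\ fv_below_tm d t
  | fBot => True
  | fImp A B => fv_below d A /\ fv_below d B
  | fAll A => fv_below (S d) A
  end.

Definition sentence (A : formula) : Prop := fv_below 0 A.

(** ** Truth in the standard model *)

Definition scons (n : nat) (e : nat -> nat) (i : nat) : nat :=
  match i with
  | 0 => n
  | S i => e i
  end.

Fixpoint eval (e : nat -> nat) (t : term) : nat :=
  match t with
  | tVar n => e n
  | tZero => 0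
  | tSucc t => S (eval e t)
  | tAdd s t => eval e s + eval e t
  | tMul s t => eval e s * eval e t
  end.

Fixpoint sat (e : nat -> nat) (A : formula) : Prop :=
  match A with
  | fEq s t => eval e s = eval e t
  | fLt s t => eval e s < eval e t
  | fBot => False
  | fImp A B => sat e A -> sat e B
  | fAll A => forall n, sat (scons n e) A
  end.

Definition true_in_N (A : formula) : Prop := forall e, sat e A.

(** ** Derivability *)

(** A Hilbert calculus for classical first-order logic with equality.
    Generalization is a rule, so the axioms in [T] are meant to be sentences. *)
Inductive proves (T : formula -> Prop) : formula -> Prop :=
| pr_ax A : T A -> proves T A
| pr_K A B : proves T (fImp A (fImp B A))
| pr_S A B C :
    proves T (fImp (fImp A (fImp B C)) (fImp (fImp A B) (fImp A C)))
| pr_DN A : proves T (fImp (fNeg (fNeg A)) A)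
| pr_inst A t : proves T (fImp (fAll A) (subst 0 t A))
| pr_dist A B : proves T (fImp (fAll (fImp A B)) (fImp (fAll A) (fAll B)))
| pr_vac A : proves T (fImp A (fAll (shift 0 A)))
| pr_refl t : proves T (fEq t t)
| pr_leibniz s t A :
    proves T (fImp (fEq s t) (fImp (subst 0 s A) (subst 0 t A)))
| pr_mp A B : proves T (fImp A B) -> proves T A -> proves T B
| pr_gen A : proves T A -> proves T (fAll A).

Definition omega_consistent (T : formula -> Prop) : Prop :=
  ~ exists A : formula,
      fv_below 1 A /\
      proves T (fNeg (fAll A)) /\
      forall n : nat, proves T (subst 0 (numeral n) A).

Definition extend (T : formula -> Prop) (A : formula) : formula -> Prop :=
  fun B => T B \/ B = A.

(** ** The arithmetical hierarchy *)

Definition fBall (t : term) (A : formula) : formula :=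
  fAll (fImp (fLt (tVar 0) (shift_tm 0 t)) A).

Definition fBex (t : term) (A : formula) : formula :=
  fEx (fAnd (fLt (tVar 0) (shift_tm 0 t)) A).

Inductive bounded : formula -> Prop :=
| bd_eq s t : bounded (fEq s t)
| bd_lt s t : bounded (fLt s t)
| bd_bot : bounded fBot
| bd_imp A B : bounded A -> bounded B -> bounded (fImp A B)
| bd_ball t A : bounded A -> bounded (fBall t A).

Inductive polarity : Type := Sigma | Pi.

Definition dual (b : polarity) : polarity :=
  match b with Sigma => Pi | Pi => Sigma end.

(** [hier b n A]: A is literally a Sigma_n (resp. Pi_n) formula.  The classes
    are not restricted to prenex formulas.  Closure under conjunction,
    disjunction and existential quantification comes from [hier_imp] and
    [hier_all], as these connectives are defined from [fImp], [fBot], [fAll].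
    Sigma_1 is closed under bounded quantification (Sigma_1-collection);
    this is not imposed at higher levels. *)
Inductive hier : polarity -> nat -> formula -> Prop :=
| hier_bounded b n A : bounded A -> hier b n A
| hier_imp b n A B : hier (dual b) n A -> hier b n B -> hier b n (fImp A B)
| hier_all n A : hier Pi (S n) A -> hier Pi (S n) (fAll A)
| hier_ball t A : hier Sigma 1 A -> hier Sigma 1 (fBall t A)
| hier_up b b' n A : hier b n A -> hier b' (S n) A.

Definition sigma : nat -> formula -> Prop := hier Sigma.

(** Sigma_n-sentences up to equivalence provable in the base theory. *)
Definition sigma_sentence (P : formula -> Prop) (n : nat) (A : formula) : Prop :=
  sentence A /\ exists B, sentence B /\ sigma n B /\ proves P (fIff A B).

(** ** Theories *)

Record base_theory (P : formula -> Prop) : Prop := {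
  base_sentences : forall A, P A -> sentence A;
  base_sound : forall A, P A -> true_in_N A;
  base_sigma1_complete :
    forall A, sentence A -> sigma 1 A -> true_in_N A -> proves P A }.

Definition is_theory (P T : formula -> Prop) : Prop :=
  (forall A, T A -> sentence A) /\ (forall A, P A -> T A).

(** * Arithmetization *)

(** ** Goedel coding *)

(** An injective pairing given by a term of the language, which lets the
    arithmetized syntactic operations below be terms as well. *)
Definition pair_nat (x y : nat) : nat := (x + y) * (x + y) + x.
Definition pair_tm (x y : term) : term := tAdd (tMul (tAdd x y) (tAdd x y)) x.

Fixpoint code_tm (t : term) : nat :=
  match t with
  | tVar n => pair_nat 0 n
  | tZero => pair_nat 1 0
  | tSucc t => pair_nat 2 (code_tm t)
  | tAdd s t => pair_nat 3 (pair_nat (code_tm s) (code_tm t))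
  | tMul s t => pair_nat 4 (pair_nat (code_tm s) (code_tm t))
  end.

Fixpoint code (A : formula) : nat :=
  match A with
  | fEq s t => pair_nat 5 (pair_nat (code_tm s) (code_tm t))
  | fLt s t => pair_nat 6 (pair_nat (code_tm s) (code_tm t))
  | fBot => pair_nat 7 0
  | fImp A B => pair_nat 8 (pair_nat (code A) (code B))
  | fAll A => pair_nat 9 (code A)
  end.

Definition tag (k : nat) (t : term) : term := pair_tm (numeral k) t.

(** The syntactic constructors acting on codes; [qBin k] is the binary
    constructor with tag [k]. *)
Definition qVar (x : term) : term := tag 0 x.
Definition qZero : term := tag 1 tZero.
Definition qSucc (x : term) : term := tag 2 x.
Definition qBin (k : nat) (x y : term) : term := tag k (pair_tm x y).
Definition qEq : term -> term -> term := qBin 5.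
Definition qBot : term := tag 7 tZero.
Definition qImp : term -> term -> term := qBin 8.
Definition qAll (x : term) : term := tag 9 x.
Definition qNeg (x : term) : term := qImp x qBot.

(** [T] is defined in N by the Sigma_1-formula [tau] (free variable 0). *)
Definition sigma1_definition (tau : formula) (T : formula -> Prop) : Prop :=
  fv_below 1 tau /\ sigma 1 tau /\
  forall n e, sat (scons n e) tau <-> exists A, T A /\ n = code A.

Definition extend_def (tau A : formula) : formula :=
  fOr tau (fEq (tVar 0) (numeral (code A))).

(** ** Inductively generated sets of numbers *)

(** A rule has metavariables [tVar 0], ..., [tVar (r_vars - 1)]. *)
Record rule : Type := Rule {
  r_vars : nat;
  r_prems : list term;
  r_side : formula;
  r_concl : term }.

Definition shiftn_tm (k : nat) (t : term) : term := Nat.iter k (shift_tm 0) t.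
Definition fExn (k : nat) (A : formula) : formula := Nat.iter k fEx A.
Definition fConj (l : list formula) : formula := fold_right fAnd fTop l.
Definition fDisj (l : list formula) : formula := fold_right fOr fBot l.

(** Goedel's beta function: r is the remainder of a modulo 1 + (i + 1) * b. *)
Definition fBeta (a b i r : term) : formula :=
  let m := tSucc (tMul (tSucc i) b) in
  fAnd (fLt r m)
       (fEx (fEq (shift_tm 0 a) (tAdd (tMul (tVar 0) (shift_tm 0 m)) (shift_tm 0 r)))).

(** [y] is obtained by the rule from entries of index [< i] of the sequence
    coded by [(a, b)]. *)
Definition fStep (a b i y : term) (r : rule) : formula :=
  let up := shiftn_tm (r_vars r) in
  fExn (r_vars r)
    (fAnd (fEq (up y) (r_concl r))
    (fAnd (r_side r)
          (fConj (map (fun p => fBex (up i)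
                    (fBeta (shift_tm 0 (up a)) (shift_tm 0 (up b)) (tVar 0)
                           (shift_tm 0 p)))
                 (r_prems r))))).

(** There are a, b, l such that [goal] is entry l of the sequence coded by
    (a, b), and every entry of index at most l follows by one of the rules
    from strictly earlier entries. *)
Definition fDerivable (rules : list rule) (goal : term) : formula :=
  fEx (fEx (fEx
    (* l = 0, b = 1, a = 2 *)
    (fAnd (fBeta (tVar 2) (tVar 1) (tVar 0) (shiftn_tm 3 goal))
          (fBall (tSucc (tVar 0))
            (* i = 0, l = 1, b = 2, a = 3 *)
            (fEx
              (* y = 0, i = 1, l = 2, b = 3, a = 4 *)
              (fAnd (fBeta (tVar 4) (tVar 3) (tVar 1) (tVar 0))
                    (fDisj (map (fStep (tVar 4) (tVar 3) (tVar 1) (tVar 0))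
                                rules)))))))).

(** ** Arithmetized syntax and provability *)

(** Judgements, in this order: x is a term (formula) with free variables below
    d; y is the shift of x with cutoff c; y is the result of substituting u
    for d in x; x is the numeral of n; x is provable.  As for codes, x, y, u
    are codes whereas c, d, n are numbers. *)
Definition jTm (d x : term) : term := tag 0 (pair_tm d x).
Definition jFm (d x : term) : term := tag 1 (pair_tm d x).
Definition jShift (c x y : term) : term := tag 2 (pair_tm c (pair_tm x y)).
Definition jSubst (d u x y : term) : term :=
  tag 3 (pair_tm d (pair_tm u (pair_tm x y))).
Definition jNum (n x : term) : term := tag 4 (pair_tm n x).
Definition jPr (x : term) : term := tag 5 x.

Definition syntax_rules : list rule :=
  let v := tVar in
  let tm_ops := [3; 4] in
  let atoms := [5; 6] in
  let bin_ops := [3; 4; 5; 6; 8] in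
  [ Rule 2 [] (fLt (v 1) (v 0)) (jTm (v 0) (qVar (v 1)));
    Rule 1 [] fTop (jTm (v 0) qZero);
    Rule 2 [jTm (v 0) (v 1)] fTop (jTm (v 0) (qSucc (v 1))) ]
  ++ map (fun k =>
       Rule 3 [jTm (v 0) (v 1); jTm (v 0) (v 2)] fTop
              (jTm (v 0) (qBin k (v 1) (v 2)))) tm_ops
  ++ map (fun k =>
       Rule 3 [jTm (v 0) (v 1); jTm (v 0) (v 2)] fTop
              (jFm (v 0) (qBin k (v 1) (v 2)))) atoms
  ++ [ Rule 1 [] fTop (jFm (v 0) qBot);
       Rule 3 [jFm (v 0) (v 1); jFm (v 0) (v 2)] fTop
              (jFm (v 0) (qImp (v 1) (v 2)));
       Rule 2 [jFm (tSucc (v 0)) (v 1)] fTop (jFm (v 0) (qAll (v 1))) ]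
  ++ [ Rule 2 [] (fLt (v 1) (v 0)) (jShift (v 0) (qVar (v 1)) (qVar (v 1)));
       Rule 2 [] (fLt (v 0) (tSucc (v 1)))
              (jShift (v 0) (qVar (v 1)) (qVar (tSucc (v 1))));
       Rule 1 [] fTop (jShift (v 0) qZero qZero);
       Rule 1 [] fTop (jShift (v 0) qBot qBot);
       Rule 3 [jShift (v 0) (v 1) (v 2)] fTop
              (jShift (v 0) (qSucc (v 1)) (qSucc (v 2)));
       Rule 3 [jShift (tSucc (v 0)) (v 1) (v 2)] fTop
              (jShift (v 0) (qAll (v 1)) (qAll (v 2))) ]
  ++ map (fun k =>
       Rule 5 [jShift (v 0) (v 1) (v 2); jShift (v 0) (v 3) (v 4)] fTop
              (jShift (v 0) (qBin k (v 1) (v 3)) (qBin k (v 2) (v 4)))) bin_ops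
  ++ [ Rule 3 [] (fLt (v 2) (v 0))
              (jSubst (v 0) (v 1) (qVar (v 2)) (qVar (v 2)));
       Rule 2 [] fTop (jSubst (v 0) (v 1) (qVar (v 0)) (v 1));
       Rule 3 [] (fLt (v 0) (tSucc (v 2)))
              (jSubst (v 0) (v 1) (qVar (tSucc (v 2))) (qVar (v 2)));
       Rule 2 [] fTop (jSubst (v 0) (v 1) qZero qZero);
       Rule 2 [] fTop (jSubst (v 0) (v 1) qBot qBot);
       Rule 4 [jSubst (v 0) (v 1) (v 2) (v 3)] fTop
              (jSubst (v 0) (v 1) (qSucc (v 2)) (qSucc (v 3)));
       Rule 5 [jShift tZero (v 1) (v 4);
               jSubst (tSucc (v 0)) (v 4) (v 2) (v 3)] fTop
              (jSubst (v 0) (v 1) (qAll (v 2)) (qAll (v 3))) ]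
  ++ map (fun k =>
       Rule 6 [jSubst (v 0) (v 1) (v 2) (v 3); jSubst (v 0) (v 1) (v 4) (v 5)]
              fTop
              (jSubst (v 0) (v 1) (qBin k (v 2) (v 4)) (qBin k (v 3) (v 5))))
         bin_ops
  ++ [ Rule 0 [] fTop (jNum tZero qZero);
       Rule 2 [jNum (v 0) (v 1)] fTop (jNum (tSucc (v 0)) (qSucc (v 1))) ].

(** The rules of [proves], in the same order.  In the axiom schemes [v 0] is a
    bound on the free variables. *)
Definition proof_rules (tau : formula) : list rule :=
  let v := tVar in
  [ Rule 1 [] tau (jPr (v 0));
    Rule 3 [jFm (v 0) (v 1); jFm (v 0) (v 2)] fTop
           (jPr (qImp (v 1) (qImp (v 2) (v 1))));
    Rule 4 [jFm (v 0) (v 1); jFm (v 0) (v 2); jFm (v 0) (v 3)] fTop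
           (jPr (qImp (qImp (v 1) (qImp (v 2) (v 3)))
                      (qImp (qImp (v 1) (v 2)) (qImp (v 1) (v 3)))));
    Rule 2 [jFm (v 0) (v 1)] fTop (jPr (qImp (qNeg (qNeg (v 1))) (v 1)));
    Rule 4 [jFm (v 0) (v 1); jTm (v 0) (v 2);
            jSubst tZero (v 2) (v 1) (v 3)] fTop
           (jPr (qImp (qAll (v 1)) (v 3)));
    Rule 3 [jFm (v 0) (v 1); jFm (v 0) (v 2)] fTop
           (jPr (qImp (qAll (qImp (v 1) (v 2)))
                      (qImp (qAll (v 1)) (qAll (v 2)))));
    Rule 3 [jFm (v 0) (v 1); jShift tZero (v 1) (v 2)] fTop
           (jPr (qImp (v 1) (qAll (v 2))));
    Rule 2 [jTm (v 0) (v 1)] fTop (jPr (qEq (v 1) (v 1)));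
    Rule 6 [jTm (v 0) (v 1); jTm (v 0) (v 2); jFm (v 0) (v 3);
            jSubst tZero (v 1) (v 3) (v 4); jSubst tZero (v 2) (v 3) (v 5)] fTop
           (jPr (qImp (qEq (v 1) (v 2)) (qImp (v 4) (v 5))));
    Rule 2 [jPr (qImp (v 0) (v 1)); jPr (v 0)] fTop (jPr (v 1));
    Rule 1 [jPr (v 0)] fTop (jPr (qAll (v 0))) ].

(** x is the code of a formula with at most the free variable 0. *)
Definition fForm1 (x : term) : formula :=
  fDerivable syntax_rules (jFm (numeral 1) x).

(** y is the code of A(n), n a numeral, where x is the code of A. *)
Definition fInstance (x n y : term) : formula :=
  fEx (fAnd (fDerivable syntax_rules (jNum (shift_tm 0 n) (tVar 0)))
            (fDerivable syntax_rules
               (jSubst tZero (tVar 0) (shift_tm 0 x) (shift_tm 0 y)))).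

Definition fPr (tau : formula) (x : term) : formula :=
  fDerivable (syntax_rules ++ proof_rules tau) (jPr x).

(** Pr(<not forall v x(v)>) and, for all w, Pr(<x(numeral of w)>). *)
Definition fMho (tau : formula) (x : term) : formula :=
  fAnd (fPr tau (qNeg (qAll x)))
       (fAll (fEx (fAnd (fInstance (shiftn_tm 2 x) (tVar 1) (tVar 0))
                        (fPr tau (tVar 0))))).

Definition omegaCon (tau : formula) : formula :=
  fNeg (fEx (fAnd (fForm1 (tVar 0)) (fMho tau (tVar 0)))).

(** [kappa] is a Kreiselian sentence of the theory defined by [tau]. *)
Definition kreiselian (P : formula -> Prop) (tau kappa : formula) : Prop :=
  sigma_sentence P 3 kappa /\
  proves P (fIff kappa (fNeg (omegaCon (extend_def tau kappa)))).

(* Main.v *)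
From Stdlib Require Import Arith List Lia Classical Factorial.
Import ListNotations.
Require Import Defs.

(** If [kappa] is true then so is the negation of the omega-consistency
    statement, so some A(x) witnesses the omega-inconsistency of T + [kappa].
    That A is such a witness is expressed by true Sigma_1-sentences together
    with one sentence "for all w, R(w)" whose instances are true and Sigma_1.
    Then each R(n) /\ ([kappa] -> A(n)) is provable in T, whereas its universal
    closure yields [kappa], hence both "for all x, A(x)" and its negation: T is
    omega-inconsistent.  So [kappa] is false and the omega-consistency statement
    of T + [kappa] is true; it means what it says because derivations, coded by
    Goedel's beta function, are arithmetized faithfully in the standard model.
    As the base theory is only assumed sound and Sigma_1-complete, it need not
    contract "for all x, y" to a single quantifier; that R has just the variable
    w is read off the shape of the omega-consistency statement. *)

Lemma forall_iff (X : Type) (P Q : X -> Prop) :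
  (forall x, P x <-> Q x) -> (forall x, P x) <-> (forall x, Q x).
Proof. firstorder. Qed.

(** * Free variables, shifting and substitution *)

Lemma fv_below_tm_mono d d' t : d <= d' -> fv_below_tm d t -> fv_below_tm d' t.
Proof. intros Hd; induction t; cbn; intuition lia. Qed.

Lemma fv_below_mono d d' A : d <= d' -> fv_below d A -> fv_below d' A.
Proof.
  revert d d'; induction A as [s t|s t| |A IHA B IHB|A IHA]; cbn; intros d d' Hd;
    try solve [intuition eauto using fv_below_tm_mono].
  apply IHA; lia.
Qed.

Lemma fv_below_tm_exists t : exists d, fv_below_tm d t.
Proof.
  induction t as [n| |t IH|s [d IHs] t [d' IHt]|s [d IHs] t [d' IHt]]; cbn;
    try solve [exists 0; exact I | exact IH].
  - exists (S n); lia.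
  - exists (max d d'); split; eapply fv_below_tm_mono; try eassumption; lia.
  - exists (max d d'); split; eapply fv_below_tm_mono; try eassumption; lia.
Qed.

(** Turns agreement on finitely many variables into extensionality of [sat], and later supplies the
    bound that the arithmetized axiom schemes ask for. *)
Lemma fv_below_exists A : exists d, fv_below d A.
Proof.
  induction A as [s t|s t| |A [d IHA] B [d' IHB]|A [d IHA]]; cbn.
  1, 2: destruct (fv_below_tm_exists s) as [d Hd], (fv_below_tm_exists t) as [d' Hd'];
    exists (max d d'); split; eapply fv_below_tm_mono; try eassumption; lia.
  - exists 0; exact I.
  - exists (max d d'); split; eapply fv_below_mono; try eassumption; lia.
  - exists d; eapply fv_below_mono; [|eassumption]; lia.
Qed.

Lemma fv_below_numeral d n : fv_below_tm d (numeral n).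
Proof. induction n; cbn; auto. Qed.

Lemma fv_below_shift_tm d c t : fv_below_tm d t -> fv_below_tm (S d) (shift_tm c t).
Proof.
  induction t as [n| | | |]; cbn; try tauto.
  destruct (c <=? n); cbn; lia.
Qed.

Lemma fv_below_shiftn_tm d k t : fv_below_tm d t -> fv_below_tm (k + d) (shiftn_tm k t).
Proof. intros H; induction k; cbn; auto using fv_below_shift_tm. Qed.

Lemma fv_below_subst_tm d k u t :
  k <= d -> fv_below_tm d u -> fv_below_tm (S d) t -> fv_below_tm d (subst_tm k u t).
Proof.
  intros Hk Hu; induction t as [n| | | |]; cbn; try tauto.
  destruct (Nat.compare_spec n k); cbn; auto; lia.
Qed.

Lemma fv_below_subst d k u A :
  k <= d -> fv_below_tm d u -> fv_below (S d) A -> fv_below d (subst k u A).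
Proof.
  revert d k u; induction A; cbn; intros d k u Hk Hu; intuition auto using fv_below_subst_tm.
  apply IHA; auto using fv_below_shift_tm; lia.
Qed.

Lemma shift_tm_closed d c t : fv_below_tm d t -> d <= c -> shift_tm c t = t.
Proof.
  intros H Hd; induction t; cbn in *; f_equal; intuition.
  destruct (Nat.leb_spec c n); auto; lia.
Qed.

Lemma shift_closed d c A : fv_below d A -> d <= c -> shift c A = A.
Proof.
  revert d c; induction A; cbn; intros d c H Hd; f_equal;
    intuition eauto using shift_tm_closed.
  eapply IHA; [eassumption|lia].
Qed.

Lemma subst_tm_closed d k u t : fv_below_tm d t -> d <= k -> subst_tm k u t = t.
Proof.
  intros H Hd; induction t; cbn in *; f_equal; intuition.
  destruct (Nat.compare_spec n k); auto; lia.
Qed.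

Lemma subst_closed d k u A : fv_below d A -> d <= k -> subst k u A = A.
Proof.
  revert d k u; induction A; cbn; intros d k u H Hd; f_equal;
    intuition eauto using subst_tm_closed.
  eapply IHA; [eassumption|lia].
Qed.

Lemma shift_numeral c n : shift_tm c (numeral n) = numeral n.
Proof. apply (shift_tm_closed 0); [apply fv_below_numeral|lia]. Qed.

(** Needed so that substituting into a bounded quantifier gives again a formula of the literal shape
    [fBall]. *)
Lemma subst_tm_shift d u t :
  subst_tm (S d) (shift_tm 0 u) (shift_tm 0 t) = shift_tm 0 (subst_tm d u t).
Proof.
  induction t as [n| | | |]; cbn; try congruence.
  destruct (Nat.compare_spec n d); cbn; auto.
  f_equal; lia.
Qed.

(** * Truth in the standard model *)

Lemma eval_agree d e e' t :
  fv_below_tm d t -> (forall i, i < d -> e i = e' i) -> eval e t = eval e' t.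
Proof. intros H He; induction t; cbn in *; f_equal; intuition. Qed.

Lemma eval_ext e e' t : (forall i, e i = e' i) -> eval e t = eval e' t.
Proof. intros He; destruct (fv_below_tm_exists t); eauto using eval_agree. Qed.

Lemma sat_agree d e e' A :
  fv_below d A -> (forall i, i < d -> e i = e' i) -> (sat e A <-> sat e' A).
Proof.
  revert d e e'; induction A as [s t|s t| |A IHA B IHB|A IHA]; cbn; intros d e e' H He.
  1, 2: rewrite (eval_agree d e e' s), (eval_agree d e e' t); tauto.
  - tauto.
  - rewrite (IHA d e e'), (IHB d e e'); tauto.
  - apply forall_iff; intros n; apply (IHA (S d)); auto.
    intros [|i] Hi; cbn; auto; apply He; lia.
Qed.

Lemma sat_ext e e' A : (forall i, e i = e' i) -> (sat e A <-> sat e' A).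
Proof. intros He; destruct (fv_below_exists A); eauto using sat_agree. Qed.

Lemma sat_closed e e' A : sentence A -> (sat e A <-> sat e' A).
Proof. intros H; apply (sat_agree 0); [exact H|lia]. Qed.

Lemma eval_numeral e n : eval e (numeral n) = n.
Proof. induction n; cbn; auto. Qed.

Lemma eval_shift_tm e c t :
  eval e (shift_tm c t) = eval (fun i => e (if c <=? i then S i else i)) t.
Proof.
  induction t as [n| | | |]; cbn; auto.
  destruct (c <=? n); auto.
Qed.

Lemma eval_shift0 n e t : eval (scons n e) (shift_tm 0 t) = eval e t.
Proof. rewrite eval_shift_tm; apply eval_ext; reflexivity. Qed.

Lemma sat_shift e c A :
  sat e (shift c A) <-> sat (fun i => e (if c <=? i then S i else i)) A.
Proof.
  revert e c; induction A; cbn; intros e c; rewrite ?eval_shift_tm; try tauto.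
  - rewrite IHA1, IHA2; tauto.
  - apply forall_iff; intros n; rewrite IHA; apply sat_ext.
    intros [|i]; cbn; auto; destruct (c <=? i); auto.
Qed.

(** Semantic counterpart of [subst d]: the substituted term's value sits at position [d], and later
    variables look one place down, as substitution decrements them. *)
Definition insert (d v : nat) (e : nat -> nat) (i : nat) : nat :=
  match i ?= d with Lt => e i | Eq => v | Gt => e (pred i) end.

Lemma eval_subst_tm e d u t : eval e (subst_tm d u t) = eval (insert d (eval e u) e) t.
Proof.
  induction t as [n| | | |]; cbn; auto.
  unfold insert; destruct (n ?= d); auto.
Qed.

Lemma sat_subst e d u A : sat e (subst d u A) <-> sat (insert d (eval e u) e) A.
Proof.
  revert e d u; induction A; cbn; intros e d u; rewrite ?eval_subst_tm; try tauto.
  - rewrite IHA1, IHA2; tauto.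
  - apply forall_iff; intros n; rewrite IHA, eval_shift0; apply sat_ext.
    intros [|i]; cbn; auto.
    unfold insert; cbn; destruct (Nat.compare_spec i d) as [| |Hi]; auto.
    destruct i; [lia|reflexivity].
Qed.

Lemma sat_subst0 e u A : sat e (subst 0 u A) <-> sat (scons (eval e u) e) A.
Proof. rewrite sat_subst; apply sat_ext; intros [|i]; reflexivity. Qed.

Lemma sat_neg e A : sat e (fNeg A) <-> ~ sat e A.
Proof. reflexivity. Qed.

(** Conjunction is a negated implication, so its components are recovered by classical reasoning in
    the metatheory; disjunction and the existential quantifier are treated likewise. *)
Lemma sat_and e A B : sat e (fAnd A B) <-> sat e A /\ sat e B.
Proof. cbn; split; [intros H; split; apply NNPP|]; tauto. Qed.

Lemma sat_or e A B : sat e (fOr A B) <-> sat e A \/ sat e B.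
Proof. cbn; destruct (classic (sat e A)); tauto. Qed.

Lemma sat_iff e A B : sat e (fIff A B) <-> (sat e A <-> sat e B).
Proof. unfold fIff; rewrite sat_and; cbn; tauto. Qed.

Lemma sat_ex e A : sat e (fEx A) <-> exists n, sat (scons n e) A.
Proof.
  cbn; split.
  - intros H; apply NNPP; intros H'; apply H; eauto.
  - intros [n Hn] H; eauto.
Qed.

Lemma sat_ball e t A :
  sat e (fBall t A) <-> forall n, n < eval e t -> sat (scons n e) A.
Proof. cbn; setoid_rewrite eval_shift0; reflexivity. Qed.

Lemma sat_bex e t A :
  sat e (fBex t A) <-> exists n, n < eval e t /\ sat (scons n e) A.
Proof.
  unfold fBex; rewrite sat_ex; setoid_rewrite sat_and; cbn.
  setoid_rewrite eval_shift0; reflexivity.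
Qed.

Lemma sat_conj e l : sat e (fConj l) <-> forall A, In A l -> sat e A.
Proof.
  induction l as [|B l IH]; [cbn; tauto|].
  change (fConj (B :: l)) with (fAnd B (fConj l)).
  rewrite sat_and, IH; cbn; split; [|auto].
  intros [HB Hl] A [<-|HA]; auto.
Qed.

Lemma sat_disj e l : sat e (fDisj l) <-> exists A, In A l /\ sat e A.
Proof.
  induction l as [|B l IH]; [cbn; firstorder|].
  change (fDisj (B :: l)) with (fOr B (fDisj l)).
  rewrite sat_or, IH; cbn; split.
  - intros [H|(A & HA & H)]; eauto.
  - intros (A & [<-|HA] & H); eauto.
Qed.

(** The k witnesses form the initial segment of one environment [e'] whose tail is [e]; this fits
    rules, whose metavariables are the first variables. *)
Lemma sat_exn e k A :
  sat e (fExn k A) <-> exists e', (forall i, e' (k + i) = e i) /\ sat e' A.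
Proof.
  revert e; induction k as [|k IH]; intros e.
  - cbn; split.
    + intros H; exists e; auto.
    + intros (e' & He & H); apply (sat_ext e' e); auto.
  - change (fExn (S k) A) with (fEx (fExn k A)).
    rewrite sat_ex; setoid_rewrite IH; split.
    + intros (n & e' & He & H); exists e'; split; auto.
      intros i; rewrite Nat.add_succ_comm; apply He.
    + intros (e' & He & H); exists (e' k), e'; split; auto.
      intros [|i]; cbn; [f_equal; lia|].
      rewrite <- He; f_equal; lia.
Qed.

Lemma eval_shiftn e e' k t :
  (forall i, e' (k + i) = e i) -> eval e' (shiftn_tm k t) = eval e t.
Proof.
  revert e'; induction k as [|k IH]; intros e' He; cbn.
  - apply eval_ext; auto.
  - rewrite eval_shift_tm; apply IH; intros i; apply He.
Qed.

Lemma soundness T A :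
  (forall B, T B -> true_in_N B) -> proves T A -> true_in_N A.
Proof.
  intros HT H; induction H; intros e; cbn.
  - apply HT; assumption.
  - tauto.
  - tauto.
  - apply NNPP.
  - intros H; apply sat_subst0; auto.
  - auto.
  - intros H n; apply sat_shift; cbn; apply (sat_ext e); auto.
  - reflexivity.
  - intros Hst; rewrite !sat_subst0, Hst; auto.
  - apply (IHproves1 e), IHproves2.
  - intros n; apply IHproves.
Qed.

(** * Derivability *)

Lemma proves_mono (T T' : formula -> Prop) A :
  (forall B, T B -> T' B) -> proves T A -> proves T' A.
Proof. intros HT H; induction H; eauto using proves. Qed.

Section Derivability.

Variable T : formula -> Prop.

Lemma pr_const A B : proves T B -> proves T (fImp A B).
Proof. intros H; eapply pr_mp; [apply pr_K|exact H]. Qed.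

Lemma pr_app A B C :
  proves T (fImp A (fImp B C)) -> proves T (fImp A B) -> proves T (fImp A C).
Proof. intros H1 H2; eapply pr_mp; [eapply pr_mp; [apply pr_S|exact H1]|exact H2]. Qed.

Lemma pr_id A : proves T (fImp A A).
Proof. eapply pr_app with (B := fImp A A); apply pr_K. Qed.

Lemma pr_trans A B C :
  proves T (fImp A B) -> proves T (fImp B C) -> proves T (fImp A C).
Proof. intros H1 H2; eapply pr_app; [apply pr_const, H2|exact H1]. Qed.

Lemma pr_contra A B : proves T (fImp A B) -> proves T (fImp (fNeg B) (fNeg A)).
Proof.
  intros H; eapply pr_app; [|apply pr_const, H].
  eapply pr_trans; [apply pr_K|apply pr_S].
Qed.

Lemma pr_neg_neg A : proves T A -> proves T (fNeg (fNeg A)).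
Proof. intros H; eapply pr_app; [apply pr_id|apply pr_const, H]. Qed.

Lemma pr_and_left A B : proves T (fImp (fAnd A B) A).
Proof.
  eapply pr_trans; [apply pr_contra|apply pr_DN].
  (* The remaining goal is $\neg A \to (A \to \neg B)$; the instance of [pr_K] is $\bot \to \neg
     B$. *)
  eapply pr_mp; [apply pr_S|apply pr_const, (pr_K T fBot B)].
Qed.

Lemma pr_and_right A B : proves T (fImp (fAnd A B) B).
Proof. eapply pr_trans; [apply pr_contra, pr_K|apply pr_DN]. Qed.

Lemma pr_and A B : proves T A -> proves T B -> proves T (fAnd A B).
Proof.
  intros HA HB; eapply pr_app; [|apply pr_const, HB].
  eapply pr_app; [apply pr_id|apply pr_const, HA].
Qed.

Lemma pr_ex A t : proves T (subst 0 t A) -> proves T (fEx A).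
Proof.
  intros H; eapply pr_app; [|apply pr_const, H].
  apply (pr_inst T (fNeg A) t).
Qed.

Lemma pr_all_mono A B :
  proves T (fImp A B) -> proves T (fImp (fAll A) (fAll B)).
Proof. intros H; eapply pr_mp; [apply pr_dist|apply pr_gen, H]. Qed.

Lemma pr_all_imp A B :
  sentence A -> proves T (fImp A B) -> proves T (fImp A (fAll B)).
Proof.
  intros HA H; eapply pr_trans; [apply pr_vac|].
  rewrite (shift_closed 0) by auto; apply pr_all_mono, H.
Qed.

(** Axioms and modus ponens are handled as in propositional logic. For generalization the quantifier
    must be moved past [A], which is possible because [A] is a sentence. *)
Lemma deduction A B :
  sentence A -> proves (extend T A) B -> proves T (fImp A B).
Proof.
  intros HA H; induction H as [B [HB| ->]| | | | | | | | |B C _ IH1 _ IH2|B _ IH];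
    try (apply pr_const; constructor; assumption).
  - apply pr_id.
  - exact (pr_app _ _ _ IH1 IH2).
  - exact (pr_all_imp _ _ HA IH).
Qed.

End Derivability.

(** * Complexity *)

Lemma bounded_subst A : bounded A -> forall d u, bounded (subst d u A).
Proof.
  induction 1; intros d u; cbn; try solve [constructor; auto].
  rewrite subst_tm_shift; apply (bd_ball (subst_tm d u t)); auto.
Qed.

(** Numerical instances thus stay literally in their class, as the appeal to Sigma_1-completeness
    requires. *)
Lemma hier_subst b n A : hier b n A -> forall d u, hier b n (subst d u A).
Proof.
  induction 1; intros d u; cbn.
  - apply hier_bounded, bounded_subst; assumption.
  - apply hier_imp; auto.
  - apply hier_all; auto.
  - rewrite subst_tm_shift; apply (hier_ball (subst_tm d u t)); auto.
  - eapply hier_up; eauto.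
Qed.

Lemma sigma1_and A B : sigma 1 A -> sigma 1 B -> sigma 1 (fAnd A B).
Proof.
  intros HA HB; apply hier_imp; [apply hier_imp; [exact HA|apply hier_imp; [exact HB|]]|];
    apply hier_bounded, bd_bot.
Qed.

Lemma sigma1_or A B : sigma 1 A -> sigma 1 B -> sigma 1 (fOr A B).
Proof.
  intros HA HB; apply hier_imp; [|exact HB].
  apply hier_imp; [exact HA|apply hier_bounded, bd_bot].
Qed.

(** The two negations around the universal quantifier flip the polarity to Pi, where [hier_all]
    applies, and back. *)
Lemma sigma1_ex A : sigma 1 A -> sigma 1 (fEx A).
Proof.
  intros HA; apply hier_imp; [apply hier_all, hier_imp; [exact HA|]|];
    apply hier_bounded, bd_bot.
Qed.

Lemma sigma1_eq s t : sigma 1 (fEq s t).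
Proof. apply hier_bounded, bd_eq. Qed.

Lemma sigma1_lt s t : sigma 1 (fLt s t).
Proof. apply hier_bounded, bd_lt. Qed.

Lemma sigma1_bot : sigma 1 fBot.
Proof. apply hier_bounded, bd_bot. Qed.

Lemma sigma1_top : sigma 1 fTop.
Proof. apply hier_bounded, bd_imp; apply bd_bot. Qed.

Lemma sigma1_bex t A : sigma 1 A -> sigma 1 (fBex t A).
Proof. intros H; apply sigma1_ex, sigma1_and; [apply sigma1_lt|exact H]. Qed.

Lemma sigma1_exn k A : sigma 1 A -> sigma 1 (fExn k A).
Proof. intros H; induction k as [|k IH]; [exact H|exact (sigma1_ex _ IH)]. Qed.

Lemma sigma1_conj l : Forall (sigma 1) l -> sigma 1 (fConj l).
Proof. induction 1; [apply sigma1_top|apply sigma1_and; assumption]. Qed.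

Lemma sigma1_disj l : Forall (sigma 1) l -> sigma 1 (fDisj l).
Proof. induction 1; [apply sigma1_bot|apply sigma1_or; assumption]. Qed.

Lemma sigma1_beta a b i r : sigma 1 (fBeta a b i r).
Proof. apply sigma1_and; [apply sigma1_lt|apply sigma1_ex, sigma1_eq]. Qed.

Lemma sigma1_step a b i y r : sigma 1 (r_side r) -> sigma 1 (fStep a b i y r).
Proof.
  intros H; apply sigma1_exn, sigma1_and; [apply sigma1_eq|].
  apply sigma1_and; [exact H|apply sigma1_conj, Forall_map].
  apply Forall_forall; intros p _; apply sigma1_bex, sigma1_beta.
Qed.

(** The universal quantifier over the entries is bounded by the length, so [hier_ball] keeps the
    formula at level 1. *)
Lemma sigma1_derivable rules goal :
  Forall (fun r => sigma 1 (r_side r)) rules -> sigma 1 (fDerivable rules goal).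
Proof.
  intros H; do 3 apply sigma1_ex; apply sigma1_and; [apply sigma1_beta|].
  apply hier_ball, sigma1_ex, sigma1_and; [apply sigma1_beta|].
  apply sigma1_disj, Forall_map; revert H; apply Forall_impl.
  intros r; apply sigma1_step.
Qed.

(** * Free variables of the derivability formulas *)

Lemma fv_below_and d A B : fv_below d (fAnd A B) <-> fv_below d A /\ fv_below d B.
Proof. cbn; tauto. Qed.

Lemma fv_below_or d A B : fv_below d (fOr A B) <-> fv_below d A /\ fv_below d B.
Proof. cbn; tauto. Qed.

Lemma fv_below_ex d A : fv_below d (fEx A) <-> fv_below (S d) A.
Proof. cbn; tauto. Qed.

Lemma fv_below_ball d t A :
  fv_below_tm d t -> fv_below (S d) A -> fv_below d (fBall t A).
Proof. cbn; auto using fv_below_shift_tm with arith. Qed.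

Lemma fv_below_bex d t A :
  fv_below_tm d t -> fv_below (S d) A -> fv_below d (fBex t A).
Proof. cbn; auto 10 using fv_below_shift_tm with arith. Qed.

Lemma fv_below_exn d k A : fv_below (k + d) A -> fv_below d (fExn k A).
Proof.
  revert d; induction k as [|k IH]; intros d H; [exact H|].
  apply fv_below_ex, IH; rewrite <- Nat.add_succ_comm; exact H.
Qed.

Lemma fv_below_conj d l : Forall (fv_below d) l -> fv_below d (fConj l).
Proof. induction 1; [cbn; tauto|apply fv_below_and; auto]. Qed.

Lemma fv_below_disj d l : Forall (fv_below d) l -> fv_below d (fDisj l).
Proof. induction 1; [cbn; tauto|apply fv_below_or; auto]. Qed.

Lemma fv_below_beta d a b i r :
  fv_below_tm d a -> fv_below_tm d b -> fv_below_tm d i -> fv_below_tm d r ->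
  fv_below d (fBeta a b i r).
Proof.
  intros; apply fv_below_and; split; [|apply fv_below_ex]; cbn;
    repeat split; auto using fv_below_shift_tm with arith.
Qed.

(** Guarantees that an instance of the rule depends only on the values of its metavariables, so the
    rest of the environment may be replaced. *)
Definition rule_closed (r : rule) : Prop :=
  fv_below_tm (r_vars r) (r_concl r) /\
  Forall (fv_below_tm (r_vars r)) (r_prems r) /\
  fv_below (r_vars r) (r_side r).

Lemma fv_below_step d a b i y r :
  rule_closed r ->
  fv_below_tm d a -> fv_below_tm d b -> fv_below_tm d i -> fv_below_tm d y ->
  fv_below d (fStep a b i y r).
Proof.
  intros (Hc & Hp & Hs) Ha Hb Hi Hy.
  apply fv_below_exn, fv_below_and; split; [|apply fv_below_and; split].
  - split; [apply fv_below_shiftn_tm, Hy|].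
    eapply fv_below_tm_mono; [|exact Hc]; lia.
  - eapply fv_below_mono; [|exact Hs]; lia.
  - apply fv_below_conj, Forall_map; revert Hp; apply Forall_impl; intros p Hp.
    apply fv_below_bex; [apply fv_below_shiftn_tm, Hi|].
    apply fv_below_beta; try apply fv_below_shift_tm;
      try apply fv_below_shiftn_tm; auto; [cbn; lia|].
    eapply fv_below_tm_mono; [|exact Hp]; lia.
Qed.

Lemma fv_below_derivable d rules goal :
  Forall rule_closed rules -> fv_below_tm d goal ->
  fv_below d (fDerivable rules goal).
Proof.
  intros Hr Hg; do 3 apply fv_below_ex.
  apply fv_below_and; split.
  - apply fv_below_beta; try (cbn; lia).
    exact (fv_below_shiftn_tm d 3 goal Hg).
  - apply fv_below_ball; [cbn; lia|].
    apply fv_below_ex, fv_below_and; split; [apply fv_below_beta; cbn; lia|].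
    apply fv_below_disj, Forall_map; revert Hr; apply Forall_impl; intros r Hr.
    apply fv_below_step; auto; cbn; lia.
Qed.

(** * Goedel's beta function *)

Definition beta (a b i r : nat) : Prop :=
  r < S (S i * b) /\ exists q, a = q * S (S i * b) + r.

Lemma beta_functional a b i r r' : beta a b i r -> beta a b i r' -> r = r'.
Proof.
  intros [Hr [q Hq]] [Hr' [q' Hq']].
  apply (Nat.div_mod_unique (S (S i * b)) q q' r r'); auto; lia.
Qed.

Lemma divide_fact k n : 0 < k <= n -> Nat.divide k (fact n).
Proof.
  induction n as [|n IH]; intros Hk; [lia|].
  change (fact (S n)) with (S n * fact n).
  destruct (Nat.eq_dec k (S n)) as [->|Hn].
  - apply Nat.divide_factor_l.
  - apply Nat.divide_mul_r, IH; lia.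
Qed.

(** The gcd g divides c, so it is coprime to m; by Gauss's lemma it divides n, hence the gcd of n
    and c. *)
Lemma gcd_mul_eq_1 m n c : Nat.gcd m c = 1 -> Nat.gcd n c = 1 -> Nat.gcd (m * n) c = 1.
Proof.
  intros Hm Hn; set (g := Nat.gcd (m * n) c).
  assert (Hc : Nat.divide g c) by apply Nat.gcd_divide_r.
  apply Nat.divide_1_r; rewrite <- Hn; apply Nat.gcd_greatest; [|exact Hc].
  apply (Nat.gauss g m n); [apply Nat.gcd_divide_l|].
  apply Nat.divide_1_r; rewrite <- Hm; apply Nat.gcd_greatest.
  - apply Nat.gcd_divide_r.
  - apply (Nat.divide_trans _ g); [apply Nat.gcd_divide_l|exact Hc].
Qed.

(* A common divisor of [1 + (i+1)b] and [1 + (j+1)b] divides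
   [(j+1)(1 + (i+1)b) - (i+1)(1 + (j+1)b) = j - i], hence [b], hence 1. *)
Lemma beta_moduli_coprime b i j :
  i < j -> Nat.divide (j - i) b -> Nat.gcd (S (S i * b)) (S (S j * b)) = 1.
Proof.
  intros Hij Hb; set (g := Nat.gcd _ _).
  assert (Hi : Nat.divide g (S (S i * b))) by apply Nat.gcd_divide_l.
  assert (Hj : Nat.divide g (S (S j * b))) by apply Nat.gcd_divide_r.
  assert (Hg : Nat.divide g (S i * b)).
  { apply Nat.divide_mul_r; apply (Nat.divide_trans _ (j - i)); [|exact Hb].
    replace (j - i) with (S j * S (S i * b) - S i * S (S j * b)) by nia.
    apply Nat.divide_sub_r; apply Nat.divide_mul_r; assumption. }
  apply Nat.divide_1_r; replace 1 with (S (S i * b) - S i * b) by lia.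
  apply Nat.divide_sub_r; assumption.
Qed.

(* Besides the solution [a], the induction carries a common multiple [M] of the
   moduli used so far which is coprime to all later ones. *)
Lemma chinese_remainder (m f : nat -> nat) n :
  (forall i, i < n -> f i < m i) ->
  (forall i j, i < j < n -> Nat.gcd (m i) (m j) = 1) ->
  exists a M, 0 < M /\
    (forall i, i < n -> Nat.divide (m i) M /\ exists q, a = q * m i + f i) /\
    (forall c, (forall i, i < n -> Nat.gcd (m i) c = 1) -> Nat.gcd M c = 1).
Proof.
  induction n as [|n IH]; intros Hf Hm.
  - exists 0, 1; split; [lia|split; [lia|]]; intros c _.
    apply Nat.divide_1_r, Nat.gcd_divide_l.
  - destruct IH as (a & M & HM & Ha & Hc); [auto|intros i j H; apply Hm; lia|].
    assert (Hn : 0 < m n) by (specialize (Hf n); lia).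
    assert (HMn : Nat.gcd M (m n) = 1) by (apply Hc; intros i Hi; apply Hm; lia).
    destruct (Nat.gcd_bezout_pos M (m n) HM) as (u & v & Huv).
    rewrite HMn in Huv.
    (* Bezout gives $uM = 1 + v\,m_n$. The correction vanishes modulo the old moduli, which divide
       M; modulo $m_n$ it equals $f(n) - a$, where $(m_n - 1)a$ stands for $-a$ to avoid
       subtraction. *)
    exists (a + M * (u * (f n + (m n - 1) * a))), (M * m n).
    split; [nia|split].
    + intros i Hi; destruct (Nat.eq_dec i n) as [->|Hin].
      * split; [apply Nat.divide_factor_r|].
        exists (a + v * (f n + (m n - 1) * a)).
        destruct (m n) as [|k]; [lia|].
        replace (S k - 1) with k by lia.
        transitivity (a + (u * M) * (f n + k * a)); [ring|rewrite Huv; ring].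
      * destruct (Ha i) as [[d Hd] [q Hq]]; [lia|].
        split; [exists (d * m n); rewrite Hd; ring|].
        exists (q + d * (u * (f n + (m n - 1) * a))).
        rewrite Hd; rewrite Hq at 1; ring.
    + intros c Hcop; apply gcd_mul_eq_1; [apply Hc; auto|apply Hcop; lia].
Qed.

(** Take $b = N!$ with N bounding n and all the values: each value is then below its modulus, and
    every difference of indices divides b, so the moduli are pairwise coprime. *)
Lemma beta_exists (f : nat -> nat) n :
  exists a b, forall i, i < n -> beta a b i (f i).
Proof.
  assert (Hmax : exists N, n <= N /\ forall i, i < n -> f i <= N).
  { induction n as [|n (N & HN & Hf)]; [exists 0; split; lia|].
    exists (S n + N + f n); split; [lia|]; intros i Hi.
    destruct (Nat.eq_dec i n) as [->|Hin]; [lia|].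
    specialize (Hf i); lia. }
  destruct Hmax as (N & HN & Hf).
  assert (Hfact : forall k, k <= fact k).
  { induction k as [|k IH]; [lia|]; cbn; pose proof (lt_O_fact k); nia. }
  pose proof (Hfact N) as HNf.
  destruct (chinese_remainder (fun i => S (S i * fact N)) f n) as (a & M & _ & Ha & _).
  - intros i Hi; specialize (Hf i Hi); nia.
  - intros i j Hij; apply beta_moduli_coprime; [lia|].
    apply divide_fact; lia.
  - exists a, (fact N); intros i Hi; split; [|apply Ha, Hi].
    specialize (Hf i Hi); nia.
Qed.

Lemma sat_beta e a b i r :
  sat e (fBeta a b i r) <-> beta (eval e a) (eval e b) (eval e i) (eval e r).
Proof.
  unfold fBeta, beta; rewrite sat_and, sat_ex; cbn.
  setoid_rewrite eval_shift0; reflexivity.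
Qed.

(** * Inductively generated sets *)

(** The set that [fDerivable] is meant to define. An instance of a rule is given by an environment
    assigning arbitrary numbers to its metavariables. *)
Inductive generated (rules : list rule) : nat -> Prop :=
| generated_rule r e :
    In r rules -> sat e (r_side r) ->
    (forall p, In p (r_prems r) -> generated rules (eval e p)) ->
    generated rules (eval e (r_concl r)).

Lemma generated_incl rules rules' n :
  incl rules rules' -> generated rules n -> generated rules' n.
Proof. intros Hr H; induction H; apply generated_rule; auto. Qed.

(** The default 0 of [nth] does no harm: [derivation] asks for this only at indices below the
    length, and premises sit at smaller ones. *)
Definition justified (rules : list rule) (s : list nat) (i : nat) : Prop :=
  exists r e, In r rules /\ nth i s 0 = eval e (r_concl r) /\ sat e (r_side r) /\
    forall p, In p (r_prems r) -> exists j, j < i /\ nth j s 0 = eval e p.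

Definition derivation (rules : list rule) (s : list nat) : Prop :=
  forall i, i < length s -> justified rules s i.

Lemma derivation_app rules s s' :
  derivation rules s -> derivation rules s' -> derivation rules (s ++ s').
Proof.
  intros Hs Hs' i Hi; rewrite length_app in Hi.
  destruct (Nat.lt_ge_cases i (length s)) as [Hl|Hl].
  - destruct (Hs i Hl) as (r & e & Hr & Hn & Hsat & Hp).
    exists r, e; rewrite app_nth1 by auto; repeat split; auto; intros p Hpr.
    destruct (Hp p Hpr) as (j & Hj & Hv).
    exists j; rewrite app_nth1 by lia; auto.
  - destruct (Hs' (i - length s)) as (r & e & Hr & Hn & Hsat & Hp); [lia|].
    exists r, e; rewrite app_nth2 by auto; repeat split; auto; intros p Hpr.
    destruct (Hp p Hpr) as (j & Hj & Hv).
    exists (length s + j); rewrite app_nth2 by lia; split; [lia|].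
    rewrite <- Hv; f_equal; lia.
Qed.

Lemma derivations_join rules (l : list nat) :
  (forall n, In n l -> exists s, derivation rules s /\ In n s) ->
  exists s, derivation rules s /\ incl l s.
Proof.
  induction l as [|n l IH]; intros H.
  - exists []; split; [intros i Hi; inversion Hi|apply incl_nil_l].
  - destruct (H n) as (s & Hs & Hn); [left; reflexivity|].
    destruct IH as (s' & Hs' & Hl); [intros k Hk; apply H; right; exact Hk|].
    exists (s ++ s'); split; [apply derivation_app; assumption|].
    apply incl_cons; [apply in_or_app; auto|apply incl_appr, Hl].
Qed.

(** The derivations of the premises are concatenated and the conclusion is appended as last
    entry. *)
Lemma generated_derivation rules n :
  generated rules n -> exists s, derivation rules s /\ In n s.
Proof.
  induction 1 as [r e Hr Hs _ IH].
  destruct (derivations_join rules (map (eval e) (r_prems r))) as (s & Hd & Hin).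
  { intros k Hk; apply in_map_iff in Hk as (p & <- & Hp); auto. }
  exists (s ++ [eval e (r_concl r)]); split;
    [|apply in_or_app; right; left; reflexivity].
  intros i Hi; rewrite length_app in Hi; cbn in Hi.
  destruct (Nat.lt_ge_cases i (length s)) as [Hl|Hl].
  - destruct (Hd i Hl) as (r' & e' & Hr' & Hn & Hs' & Hp).
    exists r', e'; rewrite app_nth1 by auto; repeat split; auto; intros p Hpr.
    destruct (Hp p Hpr) as (j & Hj & Hv).
    exists j; rewrite app_nth1 by lia; auto.
  - replace i with (length s) by lia.
    exists r, e; rewrite nth_middle; repeat split; auto; intros p Hpr.
    destruct (In_nth s (eval e p) 0) as (j & Hj & Hv).
    { apply Hin, in_map, Hpr. }
    exists j; rewrite app_nth1 by auto; auto.
Qed.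

Lemma sat_step e a b i y r :
  sat e (fStep a b i y r) <->
  exists e', (forall j, e' (r_vars r + j) = e j) /\
    eval e y = eval e' (r_concl r) /\ sat e' (r_side r) /\
    forall p, In p (r_prems r) ->
      exists j, j < eval e i /\ beta (eval e a) (eval e b) j (eval e' p).
Proof.
  unfold fStep; rewrite sat_exn.
  split; intros (e' & He & H); exists e'; (split; [exact He|]).
  - rewrite !sat_and, sat_conj in H; destruct H as (Hy & Hs & Hp).
    cbn in Hy; rewrite (eval_shiftn e) in Hy by exact He.
    repeat split; auto; intros p Hpr.
    specialize (Hp _ (in_map _ _ _ Hpr)).
    rewrite sat_bex in Hp; destruct Hp as (j & Hj & Hb).
    rewrite sat_beta, !eval_shift0, !(eval_shiftn e) in Hb by exact He.
    rewrite (eval_shiftn e) in Hj by exact He.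
    exists j; auto.
  - destruct H as (Hy & Hs & Hp).
    rewrite !sat_and, sat_conj; repeat split; auto.
    + cbn; rewrite (eval_shiftn e) by exact He; exact Hy.
    + intros A HA; apply in_map_iff in HA as (p & <- & Hpr).
      destruct (Hp p Hpr) as (j & Hj & Hb).
      rewrite sat_bex; exists j.
      rewrite sat_beta, !eval_shift0, !(eval_shiftn e) by exact He; auto.
Qed.

(** A derivation is a finite sequence of numbers, and the beta function codes every such sequence;
    conversely each decoded entry is generated, by induction on its index. *)
Lemma sat_derivable e rules goal :
  Forall rule_closed rules ->
  sat e (fDerivable rules goal) <-> generated rules (eval e goal).
Proof.
  intros Hclosed; unfold fDerivable; rewrite sat_ex; split.
  - intros (a & H); rewrite sat_ex in H; destruct H as (b & H).
    rewrite sat_ex in H; destruct H as (l & H).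
    rewrite sat_and, sat_beta, sat_ball in H; cbn [eval scons] in H; destruct H as (Hl & H).
    (* Strong induction on the index, since premises lie strictly earlier. The formula provides its
       own entry [y'], which equals [y] because beta is functional. *)
    assert (Hgen : forall i y, i < S l -> beta a b i y -> generated rules y).
    { induction i as [i IH] using lt_wf_ind; intros y Hi Hy.
      specialize (H i Hi); rewrite sat_ex in H; destruct H as (y' & H).
      rewrite sat_and, sat_beta, sat_disj in H; cbn [eval scons] in H.
      destruct H as (Hy' & A & HA & H).
      apply in_map_iff in HA as (r & <- & Hr).
      rewrite (beta_functional _ _ _ _ _ Hy Hy').
      rewrite sat_step in H; cbn [eval scons] in H; destruct H as (e' & _ & -> & Hs & Hp).
      apply generated_rule; auto; intros p Hpr.
      destruct (Hp p Hpr) as (j & Hj & Hb).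
      apply (IH j); auto; lia. }
    rewrite (eval_shiftn e _ 3) in Hl by reflexivity.
    apply (Hgen l); auto.
  - intros H; apply generated_derivation in H as (s & Hs & Hin).
    apply (In_nth _ _ 0) in Hin as (l & Hl & Hgoal).
    destruct (beta_exists (fun i => nth i s 0) (length s)) as (a & b & Hab).
    exists a; rewrite sat_ex; exists b; rewrite sat_ex; exists l.
    rewrite sat_and, sat_beta, (eval_shiftn e _ 3), sat_ball by reflexivity; cbn [eval scons].
    split; [rewrite <- Hgoal; auto|].
    intros i Hi; rewrite sat_ex; exists (nth i s 0).
    rewrite sat_and, sat_beta, sat_disj; cbn [eval scons]; split; [apply Hab; lia|].
    destruct (Hs i) as (r & e' & Hr & Hn & Hside & Hp); [lia|].
    eexists; split; [apply in_map, Hr|].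
    rewrite Forall_forall in Hclosed; destruct (Hclosed r Hr) as (Hc & Hps & Hsd).
    rewrite sat_step; cbn [eval scons].
    set (e0 := scons _ _).
    (* The metavariables keep their values from [e'], while the variables beyond them continue the
       outer environment [e0], as [sat_step] demands. *)
    set (e1 := fun j => if j <? r_vars r then e' j else e0 (j - r_vars r)).
    assert (He1 : forall j, j < r_vars r -> e' j = e1 j).
    { intros j Hj; unfold e1; apply Nat.ltb_lt in Hj; rewrite Hj; reflexivity. }
    exists e1; repeat split.
    + intros j; unfold e1; destruct (Nat.ltb_spec (r_vars r + j) (r_vars r)); [lia|].
      f_equal; lia.
    + rewrite <- (eval_agree _ _ _ _ Hc He1); exact Hn.
    + apply (sat_agree _ _ _ _ Hsd He1), Hside.
    + intros p Hpr; destruct (Hp p Hpr) as (j & Hj & Hv).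
      exists j; split; [exact Hj|].
      rewrite Forall_forall in Hps.
      rewrite <- (eval_agree _ _ _ _ (Hps p Hpr) He1), <- Hv.
      apply Hab; lia.
Qed.

(** * Codes and judgements *)

(** With $s = x + y$ the value lies between $s^2$ and $(s+1)^2$, the latter excluded, so it
    determines s and then x. *)
Lemma pair_nat_inj x y x' y' : pair_nat x y = pair_nat x' y' -> x = x' /\ y = y'.
Proof.
  unfold pair_nat; intros H.
  assert (Hs : x + y = x' + y') by nia.
  rewrite Hs in H; lia.
Qed.

Lemma code_tm_inj s t : code_tm s = code_tm t -> s = t.
Proof.
  revert t; induction s; intros t H; destruct t; cbn [code_tm] in H;
    apply pair_nat_inj in H; destruct H as [H1 H2]; try discriminate H1;
    try apply pair_nat_inj in H2; f_equal; intuition.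
Qed.

Lemma code_inj A B : code A = code B -> A = B.
Proof.
  revert B; induction A; intros B H; destruct B; cbn [code] in H;
    apply pair_nat_inj in H; destruct H as [H1 H2]; try discriminate H1;
    try apply pair_nat_inj in H2; f_equal; intuition auto using code_tm_inj.
Qed.

(** The arguments are numbers and not syntax, because rules may be instantiated with numbers that
    code nothing. *)
Inductive judgement : Type :=
| JTm (d x : nat)
| JFm (d x : nat)
| JShift (c x y : nat)
| JSubst (d u x y : nat)
| JNum (n x : nat)
| JPr (x : nat).

Definition encode (j : judgement) : nat :=
  match j with
  | JTm d x => pair_nat 0 (pair_nat d x)
  | JFm d x => pair_nat 1 (pair_nat d x)
  | JShift c x y => pair_nat 2 (pair_nat c (pair_nat x y))
  | JSubst d u x y => pair_nat 3 (pair_nat d (pair_nat u (pair_nat x y)))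
  | JNum n x => pair_nat 4 (pair_nat n x)
  | JPr x => pair_nat 5 x
  end.

Lemma encode_inj j j' : encode j = encode j' -> j = j'.
Proof.
  destruct j, j'; cbn [encode]; intros H; apply pair_nat_inj in H;
    destruct H as [H1 H]; try discriminate H1;
    repeat (apply pair_nat_inj in H; destruct H as [? H]); congruence.
Qed.

(* The rules do not tell codes of terms from codes of formulas in the shift and
   substitution judgements, so these are only meaningful for an [x] (and [u])
   known to be a code. *)
Definition holds (T : formula -> Prop) (j : judgement) : Prop :=
  match j with
  | JTm d x => exists t, x = code_tm t /\ fv_below_tm d t
  | JFm d x => exists A, x = code A /\ fv_below d A
  | JShift c x y =>
      (forall t, x = code_tm t -> y = code_tm (shift_tm c t)) /\
      (forall A, x = code A -> y = code (shift c A))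
  | JSubst d u x y => forall w, u = code_tm w ->
      (forall t, x = code_tm t -> y = code_tm (subst_tm d w t)) /\
      (forall A, x = code A -> y = code (subst d w A))
  | JNum n x => x = code_tm (numeral n)
  | JPr x => exists A, x = code A /\ proves T A
  end.

(** Stated for all numbers, so that it can be proved by induction on [generated]; injectivity of
    [encode] makes it agree with [holds] on encodings. *)
Definition valid (T : formula -> Prop) (n : nat) : Prop :=
  forall j, n = encode j -> holds T j.

Lemma valid_encode T j : valid T (encode j) <-> holds T j.
Proof.
  split; [intros H; exact (H j eq_refl)|].
  intros H j' Hj; apply encode_inj in Hj; subst; exact H.
Qed.

(** An evaluated judgement term is convertible to the encoding of its evaluated arguments, so
    [change] suffices. *)
Ltac fold_judgements :=
  repeat match goal with
  | |- context [eval ?e (jTm ?d ?x)] =>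
      change (eval e (jTm d x)) with (encode (JTm (eval e d) (eval e x)))
  | |- context [eval ?e (jFm ?d ?x)] =>
      change (eval e (jFm d x)) with (encode (JFm (eval e d) (eval e x)))
  | |- context [eval ?e (jShift ?c ?x ?y)] =>
      change (eval e (jShift c x y))
        with (encode (JShift (eval e c) (eval e x) (eval e y)))
  | |- context [eval ?e (jSubst ?d ?u ?x ?y)] =>
      change (eval e (jSubst d u x y))
        with (encode (JSubst (eval e d) (eval e u) (eval e x) (eval e y)))
  | |- context [eval ?e (jNum ?n ?x)] =>
      change (eval e (jNum n x)) with (encode (JNum (eval e n) (eval e x)))
  | |- context [eval ?e (jPr ?x)] =>
      change (eval e (jPr x)) with (encode (JPr (eval e x)))
  end.

Lemma eval_tag e k t : eval e (tag k t) = pair_nat k (eval e t).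
Proof. unfold tag, pair_tm; cbn; rewrite eval_numeral; reflexivity. Qed.

Lemma eval_qBin e k s t :
  eval e (qBin k s t) = pair_nat k (pair_nat (eval e s) (eval e t)).
Proof. unfold qBin; rewrite eval_tag; reflexivity. Qed.

Lemma eval_qNeg e t : eval e (qNeg t) = pair_nat 8 (pair_nat (eval e t) (pair_nat 7 0)).
Proof. unfold qNeg, qImp, qBot; rewrite eval_qBin, eval_tag; reflexivity. Qed.

Ltac eval_quoted :=
  fold_judgements; rewrite ?eval_qNeg; unfold qVar, qZero, qSucc, qBot, qAll, qImp, qEq;
  repeat (rewrite ?eval_tag, ?eval_qBin, ?eval_qNeg);
  cbn [eval].

Definition env (l : list nat) (i : nat) : nat := nth i l 0.

Lemma generated_at rules i l r n :
  nth_error rules i = Some r ->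
  sat (env l) (r_side r) ->
  Forall (fun p => generated rules (eval (env l) p)) (r_prems r) ->
  eval (env l) (r_concl r) = n ->
  generated rules n.
Proof.
  intros Hr Hs Hp <-; apply generated_rule; auto.
  - eapply nth_error_In, Hr.
  - apply Forall_forall, Hp.
Qed.

(* Rule [i] of the list, with metavariables instantiated by [l]. *)
Ltac use_rule i l :=
  eapply (generated_at _ i l); [reflexivity|..];
  [cbn [r_side sat fTop fNeg] | cbn [r_prems]; repeat apply Forall_cons; try apply Forall_nil
  | cbn [r_concl]; eval_quoted; reflexivity];
  eval_quoted; cbn [env nth]; auto.

(** * Completeness of the rules: correct judgements are generated *)

Definition syntax (j : judgement) : Prop := generated syntax_rules (encode j).

Lemma syntax_tm d t : fv_below_tm d t -> syntax (JTm d (code_tm t)).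
Proof.
  unfold syntax; induction t as [n| |t IH|s IHs t IHt|s IHs t IHt]; cbn [fv_below_tm code_tm];
    intros H.
  - use_rule 0 [d; n].
  - use_rule 1 [d].
  - use_rule 2 [d; code_tm t].
  - use_rule 3 [d; code_tm s; code_tm t]; apply IHs || apply IHt; tauto.
  - use_rule 4 [d; code_tm s; code_tm t]; apply IHs || apply IHt; tauto.
Qed.

Lemma syntax_fm d A : fv_below d A -> syntax (JFm d (code A)).
Proof.
  unfold syntax; revert d; induction A as [s t|s t| |A IHA B IHB|A IHA]; cbn [fv_below code];
    intros d H.
  - use_rule 5 [d; code_tm s; code_tm t]; apply syntax_tm; tauto.
  - use_rule 6 [d; code_tm s; code_tm t]; apply syntax_tm; tauto.
  - use_rule 7 [d].
  - use_rule 8 [d; code A; code B]; apply IHA || apply IHB; tauto.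
  - use_rule 9 [d; code A]; apply IHA, H.
Qed.

Lemma syntax_shift_tm c t : syntax (JShift c (code_tm t) (code_tm (shift_tm c t))).
Proof.
  unfold syntax; induction t as [n| |t IH|s IHs t IHt|s IHs t IHt];
    cbn [shift_tm code_tm].
  - destruct (Nat.leb_spec c n); cbn [code_tm].
    + use_rule 11 [c; n]; lia.
    + use_rule 10 [c; n].
  - use_rule 12 [c].
  - use_rule 14 [c; code_tm t; code_tm (shift_tm c t)].
  - use_rule 16 [c; code_tm s; code_tm (shift_tm c s); code_tm t;
      code_tm (shift_tm c t)].
  - use_rule 17 [c; code_tm s; code_tm (shift_tm c s); code_tm t;
      code_tm (shift_tm c t)].
Qed.

Lemma syntax_shift c A : syntax (JShift c (code A) (code (shift c A))).
Proof.
  unfold syntax; revert c; induction A as [s t|s t| |A IHA B IHB|A IHA];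
    intros c; cbn [shift code].
  - use_rule 18 [c; code_tm s; code_tm (shift_tm c s); code_tm t;
      code_tm (shift_tm c t)];
      apply syntax_shift_tm.
  - use_rule 19 [c; code_tm s; code_tm (shift_tm c s); code_tm t;
      code_tm (shift_tm c t)];
      apply syntax_shift_tm.
  - use_rule 13 [c].
  - use_rule 20 [c; code A; code (shift c A); code B; code (shift c B)].
  - use_rule 15 [c; code A; code (shift (S c) A)].
Qed.

Lemma syntax_subst_tm d u t :
  syntax (JSubst d (code_tm u) (code_tm t) (code_tm (subst_tm d u t))).
Proof.
  unfold syntax; induction t as [n| |t IH|s IHs t IHt|s IHs t IHt];
    cbn [subst_tm code_tm].
  - destruct (Nat.compare_spec n d) as [->|Hn|Hn].
    + use_rule 22 [d; code_tm u].
    + use_rule 21 [d; code_tm u; n].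
    + destruct n as [|n]; [lia|]; use_rule 23 [d; code_tm u; n].
  - use_rule 24 [d; code_tm u].
  - use_rule 26 [d; code_tm u; code_tm t; code_tm (subst_tm d u t)].
  - use_rule 28 [d; code_tm u; code_tm s; code_tm (subst_tm d u s); code_tm t;
      code_tm (subst_tm d u t)].
  - use_rule 29 [d; code_tm u; code_tm s; code_tm (subst_tm d u s); code_tm t;
      code_tm (subst_tm d u t)].
Qed.

Lemma syntax_subst d u A :
  syntax (JSubst d (code_tm u) (code A) (code (subst d u A))).
Proof.
  unfold syntax; revert d u; induction A as [s t|s t| |A IHA B IHB|A IHA];
    intros d u; cbn [subst code].
  - use_rule 30 [d; code_tm u; code_tm s; code_tm (subst_tm d u s); code_tm t;
      code_tm (subst_tm d u t)];
      apply syntax_subst_tm.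
  - use_rule 31 [d; code_tm u; code_tm s; code_tm (subst_tm d u s); code_tm t;
      code_tm (subst_tm d u t)];
      apply syntax_subst_tm.
  - use_rule 25 [d; code_tm u].
  - use_rule 32 [d; code_tm u; code A; code (subst d u A); code B; code (subst d u B)].
  (* The last metavariable carries the code of [u] shifted past the binder, which the first premise
     computes. *)
  - use_rule 27 [d; code_tm u; code A; code (subst (S d) (shift_tm 0 u) A);
      code_tm (shift_tm 0 u)];
      apply syntax_shift_tm.
Qed.

Lemma syntax_num n : syntax (JNum n (code_tm (numeral n))).
Proof.
  unfold syntax; induction n as [|n IH]; cbn [numeral code_tm].
  - use_rule 33 (@nil nat).
  - use_rule 34 [n; code_tm (numeral n)].
Qed.

Lemma generated_proof tau T A :
  (forall n e, sat (scons n e) tau <-> exists B, T B /\ n = code B) ->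
  proves T A -> generated (syntax_rules ++ proof_rules tau) (encode (JPr (code A))).
Proof.
  intros Hdef H.
  assert (Hsyn : forall j, syntax j ->
    generated (syntax_rules ++ proof_rules tau) (encode j)).
  { intros j; apply generated_incl, incl_appl, incl_refl. }
  induction H as [A HA|A B|A B C|A|A t|A B|A|t|s t A|A B _ IH1 _ IH2|A _ IH].
  (* The proof rules come after the 35 syntax rules, so their positions start at 35. *)
  - use_rule 35 [code A].
    apply (sat_ext (scons (code A) (fun _ => 0))).
    + intros [|[|i]]; reflexivity.
    + apply Hdef; eauto.
  - destruct (fv_below_exists (fImp A B)) as [d [HdA HdB]].
    use_rule 36 [d; code A; code B]; apply Hsyn, syntax_fm; assumption.
  - destruct (fv_below_exists (fImp A (fImp B C))) as [d [HdA [HdB HdC]]].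
    use_rule 37 [d; code A; code B; code C]; apply Hsyn, syntax_fm; assumption.
  - destruct (fv_below_exists A) as [d Hd].
    use_rule 38 [d; code A]; apply Hsyn, syntax_fm; assumption.
  (* The auxiliary implication serves to get one bound [d] for both [A] and [t], as the rule has a
     single metavariable for it. *)
  - destruct (fv_below_exists (fImp A (fEq t t))) as [d [HdA [Hdt _]]].
    use_rule 39 [d; code A; code_tm t; code (subst 0 t A)]; apply Hsyn.
    + apply syntax_fm; assumption.
    + apply syntax_tm; assumption.
    + apply syntax_subst.
  - destruct (fv_below_exists (fImp A B)) as [d [HdA HdB]].
    use_rule 40 [d; code A; code B]; apply Hsyn, syntax_fm; assumption.
  - destruct (fv_below_exists A) as [d Hd].
    use_rule 41 [d; code A; code (shift 0 A)]; apply Hsyn.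
    + apply syntax_fm; assumption.
    + apply syntax_shift.
  - destruct (fv_below_tm_exists t) as [d Hd].
    use_rule 42 [d; code_tm t]; apply Hsyn, syntax_tm; assumption.
  - destruct (fv_below_exists (fImp A (fEq s t))) as [d [HdA [Hds Hdt]]].
    use_rule 43 [d; code_tm s; code_tm t; code A; code (subst 0 s A); code (subst 0 t A)];
      apply Hsyn.
    + apply syntax_tm; assumption.
    + apply syntax_tm; assumption.
    + apply syntax_fm; assumption.
    + apply syntax_subst.
    + apply syntax_subst.
  - use_rule 44 [code A; code B]; assumption.
  - use_rule 45 [code A]; assumption.
Qed.

(** * Correctness of the rules: generated judgements hold *)

Ltac invert_codes :=
  repeat match goal with
  | H : pair_nat _ _ = pair_nat _ _ |- _ =>
      let H1 := fresh in
      apply pair_nat_inj in H; destruct H as [H1 H]; try discriminate H1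
  | H : pair_nat _ _ = code_tm ?t |- _ => destruct t; cbn [code_tm] in H
  | H : pair_nat _ _ = code ?A |- _ => destruct A; cbn [code] in H
  end.

(** For the shift and substitution rules that descend through a constructor: the tag forces the
    outermost constructor, and the premises determine the codes of its parts. *)
Ltac structural_case :=
  intros;
  repeat match goal with
  | H : _ /\ _ |- _ => destruct H
  | Hw : ?u = code_tm ?w, IH : forall w, ?u = code_tm w -> _ /\ _ |- _ =>
      specialize (IH w Hw)
  end;
  split; intros ? Hx; invert_codes; try reflexivity;
  repeat match goal with
  | H : _ = _ /\ _ |- _ => destruct H
  | H : pair_nat _ _ = pair_nat _ _ |- _ => apply pair_nat_inj in H
  end;
  repeat match goal with
  | H : ?x = code_tm _, IH : forall t, ?x = code_tm t -> _ |- _ => specialize (IH _ H)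
  | H : ?x = code _, IH : forall A, ?x = code A -> _ |- _ => specialize (IH _ H)
  end;
  cbn [shift_tm shift subst_tm subst code_tm code]; congruence.

(** Induction on generation, one case per rule in the order of the lists. The premises [jTm] and
    [jFm] of the axiom schemes ensure that the metavariables denote codes, so that the shift and
    substitution judgements become informative. *)
Lemma valid_generated tau T n :
  (forall n e, sat (scons n e) tau <-> exists B, T B /\ n = code B) ->
  generated (syntax_rules ++ proof_rules tau) n -> valid T n.
Proof.
  intros Hdef; induction 1 as [r e Hr Hs _ IH].
  apply Forall_forall in IH.
  unfold syntax_rules, proof_rules in Hr; cbn [map app In] in Hr.
  repeat (destruct Hr as [<-|Hr]; [cbn [r_concl r_prems r_side] in Hs, IH |- *|]);
    [..|destruct Hr];
    repeat (apply Forall_cons_iff in IH as [? IH]); clear IH;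
    repeat match goal with H : valid _ _ |- _ => revert H end;
    eval_quoted; rewrite !valid_encode; cbn [holds eval fTop fNeg sat] in *.
  - exists (tVar (e 1)); cbn; auto.
  - exists tZero; cbn; auto.
  - intros (t & -> & Ht); exists (tSucc t); cbn; auto.
  - intros (t & -> & Ht) (t' & -> & Ht'); exists (tAdd t t'); cbn; auto.
  - intros (t & -> & Ht) (t' & -> & Ht'); exists (tMul t t'); cbn; auto.
  - intros (t & -> & Ht) (t' & -> & Ht'); exists (fEq t t'); cbn; auto.
  - intros (t & -> & Ht) (t' & -> & Ht'); exists (fLt t t'); cbn; auto.
  - exists fBot; cbn; auto.
  - intros (A & -> & HA) (B & -> & HB); exists (fImp A B); cbn; auto.
  - intros (A & -> & HA); exists (fAll A); cbn; auto.
  - split; intros ? Hx; invert_codes; subst; cbn [shift_tm].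
    destruct (Nat.leb_spec (e 0) (e 1)); [lia|reflexivity].
  - split; intros ? Hx; invert_codes; subst; cbn [shift_tm].
    destruct (Nat.leb_spec (e 0) (e 1)); [reflexivity|lia].
  - structural_case.
  - structural_case.
  - structural_case.
  - structural_case.
  - structural_case.
  - structural_case.
  - structural_case.
  - structural_case.
  - structural_case.
  - intros w Hw; split; intros ? Hx; invert_codes; subst; cbn [subst_tm].
    destruct (Nat.compare_spec (e 2) (e 0)); [lia|reflexivity|lia].
  - intros w Hw; split; intros ? Hx; invert_codes; subst; cbn [subst_tm].
    rewrite Nat.compare_refl; exact Hw.
  - intros w Hw; split; intros ? Hx; invert_codes; subst; cbn [subst_tm].
    destruct (Nat.compare_spec (S (e 2)) (e 0)); [lia|lia|reflexivity].
  - structural_case.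
  - structural_case.
  - structural_case.
  (* Under the quantifier the substituted term is the shift of [w]; the shift premise identifies its
     code. *)
  - intros [Hu _] IHA w Hw; specialize (IHA _ (Hu w Hw)); structural_case.
  - structural_case.
  - structural_case.
  - structural_case.
  - structural_case.
  - structural_case.
  - reflexivity.
  - intros ->; reflexivity.
  - apply (sat_ext _ (scons (e 0) (fun i => e (S i)))) in Hs; [|intros [|i]; reflexivity].
    apply Hdef in Hs as (A & HA & ->); eauto using pr_ax.
  - intros (A & -> & _) (B & -> & _); exists (fImp A (fImp B A)); auto using pr_K.
  - intros (A & -> & _) (B & -> & _) (C & -> & _); eexists; split; [|apply (pr_S T A B C)].
    reflexivity.
  - intros (A & -> & _); eexists; split; [|apply (pr_DN T A)]; reflexivity.
  - intros (A & -> & _) (t & -> & _) HA; destruct (HA t eq_refl) as [_ HA'].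
    eexists; split; [|apply (pr_inst T A t)]; rewrite (HA' A eq_refl); reflexivity.
  - intros (A & -> & _) (B & -> & _); eexists; split; [|apply (pr_dist T A B)]; reflexivity.
  - intros (A & -> & _) [_ HA]; eexists; split; [|apply (pr_vac T A)].
    rewrite (HA A eq_refl); reflexivity.
  - intros (t & -> & _); eexists; split; [|apply (pr_refl T t)]; reflexivity.
  - intros (s & -> & _) (t & -> & _) (A & -> & _) Hs' Ht.
    destruct (Hs' s eq_refl) as [_ HA], (Ht t eq_refl) as [_ HA'].
    eexists; split; [|apply (pr_leibniz T s t A)].
    rewrite (HA A eq_refl), (HA' A eq_refl); reflexivity.
  (* Only an implication has tag 8, and injectivity of codes identifies its antecedent with the
     formula proved by the other premise. *)
  - intros (C & HC & HAB) (A & HA & HpA); destruct C as [| | |A' B|]; cbn [code] in HC;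
      invert_codes.
    exists B; split; [exact HC|].
    apply (pr_mp T A); [|exact HpA].
    replace A with A' by (apply code_inj; congruence); exact HAB.
  - intros (A & -> & HA); exists (fAll A); cbn; auto using pr_gen.
Qed.

(** * Arithmetized provability *)

Lemma syntax_rules_closed : Forall rule_closed syntax_rules.
Proof.
  unfold syntax_rules, rule_closed; cbn [map app].
  repeat apply Forall_cons; try apply Forall_nil; cbn;
    repeat split; repeat constructor.
Qed.

Lemma proof_rules_closed tau : fv_below 1 tau -> Forall rule_closed (proof_rules tau).
Proof.
  intros Htau; unfold proof_rules, rule_closed.
  repeat apply Forall_cons; try apply Forall_nil; cbn;
    repeat split; repeat constructor; exact Htau.
Qed.

Lemma syntax_rules_sigma1 : Forall (fun r => sigma 1 (r_side r)) syntax_rules.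
Proof.
  unfold syntax_rules; cbn [map app].
  repeat apply Forall_cons; try apply Forall_nil; apply sigma1_top || apply sigma1_lt.
Qed.

Lemma proof_rules_sigma1 tau :
  sigma 1 tau -> Forall (fun r => sigma 1 (r_side r)) (proof_rules tau).
Proof.
  intros Htau; unfold proof_rules.
  repeat apply Forall_cons; try apply Forall_nil; apply sigma1_top || exact Htau.
Qed.

Lemma sigma1_fForm1 x : sigma 1 (fForm1 x).
Proof. apply sigma1_derivable, syntax_rules_sigma1. Qed.

Lemma sigma1_fInstance x n y : sigma 1 (fInstance x n y).
Proof.
  apply sigma1_ex, sigma1_and; apply sigma1_derivable, syntax_rules_sigma1.
Qed.

Lemma sigma1_fPr tau x : sigma 1 tau -> sigma 1 (fPr tau x).
Proof.
  intros Htau; apply sigma1_derivable, Forall_app; split;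
    auto using syntax_rules_sigma1, proof_rules_sigma1.
Qed.

Lemma fv_below_fForm1 d x : fv_below_tm d x -> fv_below d (fForm1 x).
Proof.
  intros Hx; apply fv_below_derivable; [apply syntax_rules_closed|].
  cbn; tauto.
Qed.

Lemma fv_below_fInstance d x n y :
  fv_below_tm d x -> fv_below_tm d n -> fv_below_tm d y -> fv_below d (fInstance x n y).
Proof.
  intros Hx Hn Hy; apply fv_below_ex, fv_below_and.
  apply (fv_below_shift_tm d 0) in Hx, Hn, Hy.
  split; apply fv_below_derivable; try apply syntax_rules_closed;
    cbn; repeat split; auto using Nat.lt_0_succ.
Qed.

Lemma fv_below_fPr tau d x : fv_below 1 tau -> fv_below_tm d x -> fv_below d (fPr tau x).
Proof.
  intros Htau Hx; apply fv_below_derivable; [|cbn; tauto].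
  apply Forall_app; auto using syntax_rules_closed, proof_rules_closed.
Qed.

Lemma and_iff A B C D : (A <-> B) -> (C <-> D) -> (A /\ C <-> B /\ D).
Proof. tauto. Qed.

(** * Adequacy of the arithmetized notions in the standard model *)

Section Adequacy.

Variables (T : formula -> Prop) (tau : formula).
Hypothesis Hdef : sigma1_definition tau T.

Lemma syntax_holds j : syntax j -> holds T j.
Proof.
  intros H; apply valid_encode, (valid_generated tau); [apply Hdef|].
  revert H; apply generated_incl, incl_appl, incl_refl.
Qed.

Lemma sat_fForm1 e x :
  sat e (fForm1 x) <-> exists A, eval e x = code A /\ fv_below 1 A.
Proof.
  unfold fForm1; rewrite (sat_derivable _ _ _ syntax_rules_closed); fold_judgements.
  split; [exact (syntax_holds (JFm 1 _))|].
  intros (A & -> & HA); exact (syntax_fm 1 A HA).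
Qed.

(** The existential variable is forced to be the code of the numeral, and then the substitution
    judgement forces the value of [y]. *)
Lemma sat_fInstance e x n y A :
  eval e x = code A ->
  sat e (fInstance x n y) <-> eval e y = code (subst 0 (numeral (eval e n)) A).
Proof.
  intros Hx; unfold fInstance; rewrite sat_ex.
  setoid_rewrite sat_and.
  setoid_rewrite (fun e g => sat_derivable e _ g syntax_rules_closed).
  split.
  - intros (u & Hn & Hs); revert Hn Hs; fold_judgements.
    rewrite !eval_shift0; intros Hn Hs.
    apply syntax_holds in Hn; apply syntax_holds in Hs.
    exact (proj2 (Hs _ Hn) A Hx).
  - intros Hy; exists (code_tm (numeral (eval e n))); fold_judgements.
    rewrite !eval_shift0, Hx, Hy; split; [apply syntax_num|apply syntax_subst].
Qed.

Lemma sat_fPr e x :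
  sat e (fPr tau x) <-> exists A, eval e x = code A /\ proves T A.
Proof.
  destruct Hdef as (Htau & _ & Hsat).
  unfold fPr; rewrite sat_derivable;
    [|apply Forall_app; auto using syntax_rules_closed, proof_rules_closed].
  fold_judgements; split.
  - intros H; apply (valid_generated _ _ _ Hsat) in H.
    apply valid_encode in H; exact H.
  - intros (A & -> & HA); exact (generated_proof _ _ _ Hsat HA).
Qed.

Lemma sat_fMho e x A :
  eval e x = code A ->
  sat e (fMho tau x) <->
  proves T (fNeg (fAll A)) /\ forall n, proves T (subst 0 (numeral n) A).
Proof.
  intros Hx; unfold fMho; rewrite sat_and, sat_fPr, eval_qNeg.
  unfold qAll; rewrite eval_tag, Hx.
  apply and_iff.
  - split; [|intros H; exists (fNeg (fAll A)); split; [reflexivity|exact H]].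
    intros (B & HB & HpB); apply (code_inj (fNeg (fAll A))) in HB as <-; exact HpB.
  - apply forall_iff; intros n; rewrite sat_ex.
    setoid_rewrite sat_and; setoid_rewrite sat_fPr; cbn [eval scons].
    (* The double shift skips the binders for the number w and for the code y of the instance. *)
    assert (Hx' : forall y, eval (scons y (scons n e)) (shiftn_tm 2 x) = code A).
    { intros y; rewrite (eval_shiftn e _ 2); auto. }
    setoid_rewrite (fun y => sat_fInstance _ _ (tVar 1) (tVar 0) A (Hx' y)).
    cbn [eval scons]; split.
    + intros (y & Hy & B & HB & HpB).
      rewrite Hy in HB; apply code_inj in HB as <-; exact HpB.
    + eauto.
Qed.

(** [fForm1] restricts the number quantifier to codes of formulas in one variable, so it ranges over
    the possible witnesses of omega-inconsistency. *)
Lemma sat_omegaCon e : sat e (omegaCon tau) <-> omega_consistent T.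
Proof.
  unfold omegaCon, omega_consistent; rewrite sat_neg, sat_ex.
  setoid_rewrite sat_and; setoid_rewrite sat_fForm1; cbn [eval scons].
  apply not_iff_compat; split.
  - intros (x & (A & -> & HA) & H); exists A; split; [exact HA|].
    apply (sat_fMho _ (tVar 0) A) in H; [exact H|reflexivity].
  - intros (A & HA & H); exists (code A); split; [eauto|].
    apply (sat_fMho _ (tVar 0) A); [reflexivity|exact H].
Qed.

End Adequacy.

Lemma sigma1_definition_extend tau T A :
  sigma1_definition tau T -> sigma1_definition (extend_def tau A) (extend T A).
Proof.
  intros (Hfv & Hs & Hdef); split; [|split; [|intros n e; split]].
  - apply fv_below_or; split; [exact Hfv|].
    split; [cbn; auto|apply fv_below_numeral].
  - apply sigma1_or; [exact Hs|apply sigma1_eq].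
  - unfold extend_def; rewrite sat_or, Hdef; cbn [sat eval scons].
    rewrite eval_numeral; unfold extend.
    intros [(B & HB & ->)| ->]; eauto.
  - unfold extend_def; rewrite sat_or, Hdef; cbn [sat eval scons].
    rewrite eval_numeral; intros (B & [HB| ->] & ->); eauto.
Qed.

(** * Kreiselian sentences *)

Lemma true_kreiselian_omega_inconsistent P T tau kappa :
  base_theory P -> is_theory P T -> sigma1_definition tau T ->
  kreiselian P tau kappa -> true_in_N kappa -> ~ omega_consistent T.
Proof.
  intros HP [_ HPT] Htau [[Hk _] Hkappa] Htrue Homega.
  set (tau' := extend_def tau kappa) in *.
  pose proof (sigma1_definition_extend _ _ kappa Htau) as Htau'.
  fold tau' in Htau'; pose proof Htau' as (Hfv & Hs1 & _).
  set (e := fun _ : nat => 0).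
  pose proof (soundness _ _ (base_sound _ HP) Hkappa e) as Hsat.
  rewrite sat_iff, sat_neg in Hsat.
  pose proof (proj1 Hsat (Htrue e)) as Hcon; clear Hsat.
  unfold omegaCon in Hcon; rewrite sat_neg, sat_ex in Hcon.
  apply NNPP in Hcon as (k & Hform).
  rewrite sat_and in Hform; destruct Hform as [Hform Hmho].
  pose proof Hform as HA; apply (sat_fForm1 _ _ Htau') in HA as (A & HkA & HA).
  cbn [eval scons] in HkA.
  pose proof Hmho as HpA; apply (sat_fMho _ _ Htau' (scons k e) (tVar 0) A HkA) in HpA.
  destruct HpA as [HnA HpA].
  unfold fMho in Hmho; rewrite sat_and in Hmho; destruct Hmho as [Hpr Hall].
  set (form := fForm1 (tVar 0)) in *.
  set (pr := fPr tau' (qNeg (qAll (tVar 0)))) in *.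
  (* In [inst] variable 0 is w and variable 1 is the code x; putting the numeral of [k] for variable
     1 will leave w as the only variable. *)
  set (inst := fEx (fAnd (fInstance (shiftn_tm 2 (tVar 0)) (tVar 1) (tVar 0))
                         (fPr tau' (tVar 0)))) in *.
  assert (Hinst_fv : fv_below 2 inst).
  { apply fv_below_ex, fv_below_and; split.
    - apply fv_below_fInstance; cbn; lia.
    - apply fv_below_fPr; [exact Hfv|cbn; lia]. }
  assert (Hinst_s1 : sigma 1 inst).
  { apply sigma1_ex, sigma1_and; [apply sigma1_fInstance|apply sigma1_fPr, Hs1]. }
  assert (HTsub : forall B, proves P B -> proves T B).
  { intros B; apply proves_mono, HPT. }
  (* True numerical instances of Sigma_1-formulas are provable in [P] by Sigma_1-completeness, hence
     in [T]. *)
  assert (Htruth : forall B n e', fv_below 1 B -> sigma 1 B -> sat (scons n e') B ->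
    proves T (subst 0 (numeral n) B)).
  { intros B n e' HB HB1 Hsat; apply HTsub, (base_sigma1_complete _ HP).
    - apply fv_below_subst; auto using fv_below_numeral.
    - apply hier_subst, HB1.
    - intros e0; apply sat_subst0; rewrite eval_numeral.
      revert Hsat; apply (sat_agree 1); auto.
      intros [|i] Hi; [reflexivity|lia]. }
  set (R := subst 1 (numeral k) inst).
  assert (HR_fv : fv_below 1 R).
  { apply fv_below_subst; auto using fv_below_numeral. }
  assert (Hdeduct : forall B, proves (extend T kappa) B -> proves T (fImp kappa B)).
  { intros B; apply deduction, Hk. }
  set (psi := fAnd R (fImp kappa A)).
  assert (Hpsi : fv_below 1 psi).
  { apply fv_below_and; split; [exact HR_fv|]; split; [|exact HA].
    apply (fv_below_mono 0); auto. }
  apply Homega; exists psi; split; [exact Hpsi|split].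
  (* The negation is an implication to [fBot], and closedness of [fAll psi] unfolds to [Hpsi]. *)
  - apply deduction; [exact Hpsi|].
    set (T1 := extend T (fAll psi)).
    assert (HT1 : forall B, proves T B -> proves T1 B).
    { intros B; apply proves_mono; left; assumption. }
    assert (Hall_psi : proves T1 (fAll psi)) by (apply pr_ax; right; reflexivity).
    assert (Hall_R : proves T1 (fAll R)).
    { eapply pr_mp; [apply pr_all_mono, pr_and_left|exact Hall_psi]. }
    assert (Hall_imp : proves T1 (fAll (fImp kappa A))).
    { eapply pr_mp; [apply pr_all_mono, pr_and_right|exact Hall_psi]. }
    (* The numeral of [k] is the witness: two conjuncts are true Sigma_1-sentences and the third is
       the universal closure of [R], given by [fAll psi]. *)
    assert (Hnc : proves T1 (fNeg (omegaCon tau'))).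
    { apply pr_neg_neg, (pr_ex _ _ (numeral k)).
      change (proves T1 (fAnd (subst 0 (numeral k) form)
        (fAnd (subst 0 (numeral k) pr) (fAll (subst 1 (shift_tm 0 (numeral k)) inst))))).
      rewrite shift_numeral.
      apply pr_and; [|apply pr_and; [|exact Hall_R]]; apply HT1.
      - apply (Htruth form k e); [apply fv_below_fForm1; cbn; lia
          |apply sigma1_fForm1|exact Hform].
      - apply (Htruth pr k e); [apply fv_below_fPr; [exact Hfv|cbn; lia]
          |apply sigma1_fPr, Hs1|exact Hpr]. }
    assert (Hkap : proves T1 kappa).
    { eapply pr_mp; [|exact Hnc].
      eapply pr_mp; [apply pr_and_right|apply HT1, HTsub, Hkappa]. }
    (* Given [kappa], the theory refutes [fAll A] by the choice of [A], yet derives it from the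
       second conjunct of [psi]. *)
    apply (pr_mp _ (fAll A)).
    + eapply pr_mp; [apply HT1, Hdeduct, HnA|exact Hkap].
    + eapply pr_mp; [|apply pr_gen, Hkap].
      eapply pr_mp; [apply pr_dist|exact Hall_imp].
  - intros n.
    change (proves T (fAnd (subst 0 (numeral n) R)
      (fImp (subst 0 (numeral n) kappa) (subst 0 (numeral n) A)))).
    rewrite (subst_closed 0 _ _ kappa) by auto.
    apply pr_and; [|apply Hdeduct, HpA].
    apply (Htruth R n e HR_fv); [apply hier_subst, Hinst_s1|].
    (* Inserting [k] at position 1 turns the environment into [scons n (scons k e)], that of
       [Hall n]. *)
    apply sat_subst; rewrite eval_numeral.
    generalize (Hall n); apply sat_ext; intros [|[|i]]; reflexivity.
Qed.

Theorem theorem2p8 (P T : formula -> Prop) (tau kappa : formula)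
    (HP : base_theory P)
    (HT : is_theory P T)
    (Hre : sigma1_definition tau T)
    (Homega : omega_consistent T)
    (Hkappa : kreiselian P tau kappa) :
  ~ true_in_N kappa /\ omega_consistent (extend T kappa).
Proof.
  assert (Hfalse : ~ true_in_N kappa).
  { intros Htrue.
    exact (true_kreiselian_omega_inconsistent P T tau kappa HP HT Hre Hkappa Htrue Homega). }
  split; [exact Hfalse|].
  destruct Hkappa as [[Hk _] Hkappa].
  (* By adequacy it is enough that the omega-consistency sentence is true; were it false, soundness
     applied to the Kreiselian equivalence would make [kappa] true. *)
  apply (sat_omegaCon _ _ (sigma1_definition_extend _ _ kappa Hre) (fun _ => 0)).
  apply NNPP; intros Hcon; apply Hfalse; intros e.
  apply (sat_closed (fun _ => 0)); [exact Hk|].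
  pose proof (soundness _ _ (base_sound _ HP) Hkappa (fun _ => 0)) as Hsat.
  rewrite sat_iff, sat_neg in Hsat; tauto.
Qed.
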